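(* Let $m_1, m_2, n_1, n$ be positive integers with $m_1 \ge n_1$ and $m_2 \ge n_1$, and consider the block tensor $$\mathcal{Q}=\begin{bmatrix}\mathcal{Q}_1\\ \mathcal{Q}_2\end{bmatrix},\qquad \mathcal{Q}_1\in\mathbb{R}^{m_1\times n_1\times n},\quad \mathcal{Q}_2\in\mathbb{R}^{m_2\times n_1\times n}.$$ If $\mathcal{Q}$ is partially orthogonal, then there exist orthogonal tensors $\mathcal{U}\in\mathbb{R}^{m_1\times m_1\times n}$, $\mathcal{V}\in\mathbb{R}^{m_2\times m_2\times n}$ and $\mathcal{Z}\in\mathbb{R}^{n_1\times n_1\times n}$ such that $$\begin{bmatrix}\mathcal{U} & \mathcal{O}\\ \mathcal{O} & \mathcal{V}\end{bmatrix}^{\mathrm T} * \begin{bmatrix}\mathcal{Q}_1\\ \mathcal{Q}_2\end{bmatrix} * \mathcal{Z} = \begin{bmatrix}\mathcal{C}\\ \mathcal{S}\end{bmatrix},$$ where $\mathcal{C}\in\mathbb{R}^{m_1\times n_1\times n}$ and $\mathcal{S}\in\mathbb{R}^{m_2\times n_1\times n}$ are f-diagonal tensors satisfying $$\mathcal{C}^{\mathrm T}*\mathcal{C}+\mathcal{S}^{\mathrm T}*\mathcal{S}=\mathcal{I}_{n_1n_1n}.$$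
   Context: All tensors are third-order arrays. For $\mathcal{A}\in\mathbb{R}^{n_1\times n_2\times n_3}$, the frontal slices are the matrices $A_k=\mathcal{A}(:,:,k)\in\mathbb{R}^{n_1\times n_2}$, $k=1,\dots,n_3$. $\mathrm{unfold}(\mathcal{A})$ is the $n_1n_3\times n_2$ matrix obtained by stacking $A_1,\dots,A_{n_3}$ vertically, $\mathrm{fold}$ is its inverse operation, and $\mathrm{bcirc}(\mathcal{A})$ is the $n_1n_3\times n_2n_3$ block circulant matrix whose $(i,j)$ block is $A_{((i-j)\bmod n_3)+1}$ (so its first block column is $\mathrm{unfold}(\mathcal{A})$). T-product: for $\mathcal{A}\in\mathbb{R}^{n_1\times n_2\times n_3}$ and $\mathcal{B}\in\mathbb{R}^{n_2\times p\times n_3}$, $\mathcal{A}*\mathcal{B}=\mathrm{fold}(\mathrm{bcirc}(\mathcal{A})\cdot\mathrm{unfold}(\mathcal{B}))\in\mathbb{R}^{n_1\times p\times n_3}$. Transpose: $\mathcal{A}^{\mathrm T}\in\mathbb{R}^{n_2\times n_1\times n_3}$ is obtained by transposing each frontal slice and then reversing the order of the transposed slices $2$ through $n_3$. Identity tensor: $\mathcal{I}_{mm\ell}\in\mathbb{R}^{m\times m\times \ell}$ has first frontal slice the $m\times m$ identity matrix and all other frontal slices zero. $\mathcal{O}$ denotes a zero tensor of the appropriate size. A tensor $\mathcal{Q}\in\mathbb{R}^{m\times m\times\ell}$ is orthogonal if $\mathcal{Q}^{\mathrm T}*\mathcal{Q}=\mathcal{Q}*\mathcal{Q}^{\mathrm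 T}=\mathcal{I}_{mm\ell}$. A tensor $\mathcal{Q}\in\mathbb{R}^{p\times q\times\ell}$ is partially orthogonal if $\mathcal{Q}^{\mathrm T}*\mathcal{Q}=\mathcal{I}_{qq\ell}$. A tensor is f-diagonal if each of its frontal slices is a (possibly rectangular) diagonal matrix. A block tensor is the tensor whose $k$-th frontal slice is the block matrix formed from the $k$-th frontal slices of the blocks. *)

(* Defs.v *)
From mathcomp Require Import all_boot all_order all_algebra.
From mathcomp Require Import reals.

Set Implicit Arguments.
Unset Strict Implicit.
Unset Printing Implicit Defensive.

Import GRing.Theory.
Local Open Scope ring_scope.

(* A tensor in R^(m x p x l), given by its frontal slices; the slice that is
   A_(k+1) with 1-based indexing is [A k], for k : 'I_l. *)
Definition tensor (R : realType) (m p l : nat) := {ffun 'I_l -> 'M[R]_(m, p)}.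

Lemma submod_subproof l (i j : 'I_l) : ((i + (l - j)) %% l < l)%N.
Proof. by rewrite ltn_pmod // (leq_ltn_trans _ (ltn_ord i)). Qed.

(* (i - j) mod l; the summand l avoids truncated subtraction. *)
Definition submod l (i j : 'I_l) : 'I_l := Ordinal (submod_subproof i j).

Lemma oppmod_subproof l (k : 'I_l) : ((l - k) %% l < l)%N.
Proof. by rewrite ltn_pmod // (leq_ltn_trans _ (ltn_ord k)). Qed.

(* (- k) mod l: fixes 0 and reverses the order of 1, ..., l - 1. *)
Definition oppmod l (k : 'I_l) : 'I_l := Ordinal (oppmod_subproof k).

Section TensorOps.
Variable R : realType.

Definition unfold m p l (A : tensor R m p l) : 'M[R]_(\sum_(k < l) m, p) :=
  \mxcol_(k < l) A k.

Definition fold m p l (M : 'M[R]_(\sum_(k < l) m, p)) : tensor R m p l :=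
  [ffun k => submxcol M k].

Definition bcirc m p l (A : tensor R m p l) :
    'M[R]_(\sum_(i < l) m, \sum_(j < l) p) :=
  \mxblock_(i < l, j < l) A (submod i j).

Definition tprod m p q l (A : tensor R m p l) (B : tensor R p q l) :
  tensor R m q l := fold (bcirc A *m unfold B).

Definition ttr m p l (A : tensor R m p l) : tensor R p m l :=
  [ffun k => (A (oppmod k))^T].

Definition tid m l : tensor R m m l :=
  [ffun k : 'I_l => if k == 0%N :> nat then 1%:M else 0].

Definition torthogonal m l (Q : tensor R m m l) : Prop :=
  tprod (ttr Q) Q = tid m l /\ tprod Q (ttr Q) = tid m l.

Definition tpartially_orthogonal m p l (Q : tensor R m p l) : Prop :=
  tprod (ttr Q) Q = tid p l.

(* [is_diag_mx] allows rectangular matrices: it says that the (i, j) entry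
   vanishes whenever i and j differ as natural numbers. *)
Definition f_diagonal m p l (A : tensor R m p l) : Prop :=
  forall k : 'I_l, is_diag_mx (A k).

Definition tcol m1 m2 p l (A : tensor R m1 p l) (B : tensor R m2 p l) :
  tensor R (m1 + m2) p l := [ffun k => col_mx (A k) (B k)].

Definition tblock m1 m2 p1 p2 l
    (A : tensor R m1 p1 l) (B : tensor R m1 p2 l)
    (C : tensor R m2 p1 l) (D : tensor R m2 p2 l) :
  tensor R (m1 + m2) (p1 + p2) l :=
  [ffun k => block_mx (A k) (B k) (C k) (D k)].

End TensorOps.

Lemma unfoldK (R : realType) m p l : cancel (@unfold R m p l) (@fold R m p l).
Proof. by move=> A; apply/ffunP=> k; rewrite ffunE mxcolK. Qed.

Lemma foldK (R : realType) m p l : cancel (@fold R m p l) (@unfold R m p l).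
Proof.
by move=> M; rewrite -[RHS]submxcolK; apply: eq_mxcol => k; rewrite ffunE.
Qed.

Lemma tprodE (R : realType) m p q l (A : tensor R m p l) (B : tensor R p q l) k :
  tprod A B k = \sum_(j < l) A (submod k j) *m B j.
Proof.
rewrite ffunE /bcirc /unfold mxblockEh mul_mxrow_mxcol.
under eq_bigr do rewrite mxcol_mul.
by rewrite -mxcol_sum mxcolK.
Qed.

(* Main.v *)
Require Import Defs.
From mathcomp Require Import all_boot all_order all_algebra.
From mathcomp Require Import cyclic separable cyclotomic complex reals.

(** The discrete Fourier transform along the third mode turns the t-product
    into a slicewise matrix product over R[i] and the tensor transpose into the
    conjugate transpose of each slice, so the theorem follows from a CS
    decomposition of each Fourier slice.  A family of complex slices is the
    transform of a real tensor exactly when the slices k and - k are conjugate: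
    the decomposition is chosen for one slice of each conjugate pair and
    conjugated for the other, and a slice with k = - k is real and gets a real
    decomposition.  For one slice, diagonalize Q1^* Q1 by a unitary Z; since
    Q1^* Q1 + Q2^* Q2 = 1, both Q1 Z and Q2 Z then have orthogonal columns, and
    any orthonormal basis extending their normalized columns gives U and V. *)

Set Implicit Arguments.
Unset Strict Implicit.
Unset Printing Implicit Defensive.

Import Order.TTheory GRing.Theory Num.Theory.
Local Open Scope ring_scope.

(* Used with (R, id) and (R[i], conjugation), so that real slices get real
   factors. *)
Section Involution.
Variables (F : fieldType) (conj : {rmorphism F -> F}).
Hypothesis conjK : involutive conj.

(** * Conjugate transpose *)

Definition dag m p (A : 'M[F]_(m, p)) : 'M[F]_(p, m) := map_mx conj A^T.

Lemma dagE m p (A : 'M[F]_(m, p)) i j : dag A i j = conj (A j i).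
Proof. by rewrite !mxE. Qed.

Lemma dagK m p (A : 'M[F]_(m, p)) : dag (dag A) = A.
Proof. by apply/matrixP=> i j; rewrite !dagE conjK. Qed.

Lemma dagM m p q (A : 'M[F]_(m, p)) (B : 'M[F]_(p, q)) :
  dag (A *m B) = dag B *m dag A.
Proof. by rewrite /dag trmx_mul map_mxM. Qed.

Lemma dag0 m p : dag (0 : 'M[F]_(m, p)) = 0.
Proof. by rewrite /dag trmx0 map_mx0. Qed.

Lemma dagZ m p a (A : 'M[F]_(m, p)) : dag (a *: A) = conj a *: dag A.
Proof. by rewrite /dag linearZ map_mxZ. Qed.

Lemma dag_col_mx m1 m2 p (A : 'M[F]_(m1, p)) (B : 'M[F]_(m2, p)) :
  dag (col_mx A B) = row_mx (dag A) (dag B).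
Proof. by rewrite /dag tr_col_mx map_row_mx. Qed.

Lemma dag_row_mx m1 m2 p (A : 'M[F]_(p, m1)) (B : 'M[F]_(p, m2)) :
  dag (row_mx A B) = col_mx (dag A) (dag B).
Proof. by rewrite /dag tr_row_mx map_col_mx. Qed.

Lemma dag_block_mx m1 m2 p1 p2 (A : 'M[F]_(m1, p1)) (B : 'M_(m1, p2))
    (C : 'M_(m2, p1)) (D : 'M_(m2, p2)) :
  dag (block_mx A B C D) = block_mx (dag A) (dag C) (dag B) (dag D).
Proof. by rewrite /dag tr_block_mx map_block_mx. Qed.

Lemma dag_diag_mx m (d : 'rV[F]_m) : dag (diag_mx d) = diag_mx (map_mx conj d).
Proof.
by apply/matrixP=> i j; rewrite dagE !mxE eq_sym rmorphMn; case: eqP => [->|].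
Qed.

Lemma dag_mul_comm0 m p q (A : 'M[F]_(m, q)) (B : 'M[F]_(p, q)) :
  A *m dag B = 0 -> B *m dag A = 0.
Proof. by move/(congr1 (@dag _ _)); rewrite dagM dagK dag0. Qed.

(** * Normalization and orthonormal completion *)

Hypothesis norm_sqrt : forall m (v : 'rV[F]_m), v != 0 ->
  exists s, [/\ conj s = s, s != 0 & s * s = (v *m dag v) 0 0].

Lemma normalize m (v : 'rV[F]_m) : v != 0 ->
  exists a w, [/\ a != 0, v = a *: w & w *m dag w = 1%:M].
Proof.
move=> /norm_sqrt[s [cs s0 ss]]; exists s, (s^-1 *: v); split => //.
  by rewrite scalerA divff // scale1r.
rewrite dagZ fmorphV cs -scalemxAl -scalemxAr [v *m _]mx11_scalar -ss.
by rewrite !scale_scalar_mx mulKf // mulVf.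
Qed.

Lemma orthogonal_row m p (B : 'M[F]_(p, m)) : (p < m)%N ->
  exists2 u : 'rV[F]_m, u != 0 & u *m dag B = 0.
Proof.
move=> ltpm; have: kermx (dag B) != 0.
  rewrite -mxrank_eq0 mxrank_ker subn_eq0 -ltnNge.
  exact: leq_ltn_trans (rank_leq_col _) _.
by case/rowV0Pn=> u /sub_kermxP uB u0; exists u.
Qed.

(* The frame E records the rows already chosen; a zero row of N leaves its
   unit vector free, so it is picked orthogonal to E and to all later rows. *)
Lemma orthogonal_rows_ext p q m (N : 'M[F]_(p, m)) (E : 'M[F]_(q, m)) :
  (q + p <= m)%N -> is_diag_mx (N *m dag N) -> N *m dag E = 0 ->
  E *m dag E = 1%:M ->
  exists d (W : 'M[F]_(p, m)),
    [/\ W *m dag W = 1%:M, W *m dag E = 0 & N = diag_mx d *m W].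
Proof.
elim: p q N E => [|p IHp] q.
  move=> N E _ _ _ _; exists 0, 0; split; by apply/matrixP=> - [].
rewrite -[p.+1]/(1 + p)%N => N E leqpm dN NE EE.
rewrite -(vsubmxK N) in dN NE *.
set x := usubmx N in dN NE *; set N' := dsubmx N in dN NE *.
have [xE N'E]: x *m dag E = 0 /\ N' *m dag E = 0.
  by move: NE; rewrite mul_col_mx -(col_mx0 F) => /eq_col_mx.
move: dN; rewrite dag_col_mx mul_col_row is_diag_block_mx //.
case/and4P=> /eqP xN' _ _ dN'.
have [a [w [xw ww wE wN']]]: exists a w,
    [/\ x = a *: w, w *m dag w = 1%:M, w *m dag E = 0 & w *m dag N' = 0].
  have [x0|/normalize[a [w [a0 xw ww]]]] := eqVneq x 0.
    have [|u u0] := @orthogonal_row _ _ (col_mx E N').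
      by rewrite addnA addn1 addSn in leqpm.
    rewrite dag_col_mx mul_mx_row -(row_mx0 F) => /eq_row_mx[uE uN'].
    have [b [w [b0 uw ww]]] := normalize u0.
    exists 0, w; rewrite scale0r x0; split => //;
      by apply: (scalerI b0); rewrite scaler0 scalemxAl -uw.
  by exists a, w; split => //; apply: (scalerI a0); rewrite scaler0 scalemxAl -xw.
(* Moving [w] into the frame keeps the total number of rows and forces the later rows of [W] to be
   orthogonal to [w]. *)
have [||||d [W [WW WwE N'W]]] := IHp _ N' (col_mx w E).
- by rewrite (addnC 1%N) -addnA.
- exact: dN'.
- by rewrite dag_col_mx mul_mx_row N'E (dag_mul_comm0 wN') row_mx0.
- by rewrite dag_col_mx mul_col_row ww EE wE (dag_mul_comm0 wE) -scalar_mx_block.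
move: WwE; rewrite dag_col_mx mul_mx_row -(row_mx0 F) => /eq_row_mx[Ww WE].
exists (row_mx a%:M d), (col_mx w W); split.
- by rewrite dag_col_mx mul_col_row ww WW Ww (dag_mul_comm0 Ww) -scalar_mx_block.
- by rewrite mul_col_mx wE WE col_mx0.
- rewrite diag_mx_row mul_block_col !mul0mx addr0 add0r -N'W xw; congr col_mx.
  rewrite -mul_scalar_mx; congr (_ *m _).
  by apply/matrixP=> i j; rewrite !mxE !ord1 !eqxx.
Qed.

Lemma orthogonal_rows m p (N : 'M[F]_(p, m)) :
  (p <= m)%N -> is_diag_mx (N *m dag N) ->
  exists d (W : 'M[F]_(p, m)), W *m dag W = 1%:M /\ N = diag_mx d *m W.
Proof.
move=> lepm dN; have [||||d [W [WW _ NW]]] := @orthogonal_rows_ext _ 0 _ N 0.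
- by [].
- by [].
- by rewrite dag0 mulmx0.
- by apply/matrixP=> - [].
by exists d, W.
Qed.

(* Padding the rows of A^* by zero rows makes the orthonormal frame of
   [orthogonal_rows] a full basis. *)
Lemma orthogonal_cols_diag m p (A : 'M[F]_(m, p)) :
  (p <= m)%N -> is_diag_mx (dag A *m A) ->
  exists2 U : 'M[F]_m, U *m dag U = 1%:M & is_diag_mx (U *m A).
Proof.
move=> lepm; rewrite -(subnKC lepm) in A *; set s := (m - p)%N in A *.
move=> dA; have [||d [W [WW NW]]] :=
  @orthogonal_rows _ _ (col_mx (dag A) (0 : 'M_(s, _))).
- by [].
- rewrite dag_col_mx dagK dag0 mul_col_row !mul0mx mulmx0.
  by rewrite is_diag_block_mx // dA mx0_is_diag !eqxx.
(* The adjoint of [NW] reads [row_mx A 0 = dag W *m dag (diag_mx d)], so multiplying by [W] leaves a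
   square diagonal matrix, whose left block is [W *m A]. *)
exists W => //; have: W *m row_mx A 0 = diag_mx (map_mx conj d).
  rewrite -[row_mx A 0]dagK dag_row_mx dag0 NW dagM mulmxA WW mul1mx.
  exact: dag_diag_mx.
rewrite mul_mx_row => /(congr1 lsubmx); rewrite row_mxKl => ->.
apply/is_diag_mxP=> i j ij; rewrite !mxE -val_eqE /=; case: eqP => // eij.
by rewrite eij eqxx in ij.
Qed.

(** * Spectral theorem and CS decomposition of one slice *)

Hypothesis hermitian_eigenvalue : forall m (A : 'M[F]_m.+1),
  dag A = A -> exists a, eigenvalue A a.

(** Deflation: split off a unit eigenvector [w], compress [A] to the orthogonal complement of [w],
    and recurse. *)
Lemma hermitian_diag m (A : 'M[F]_m) : dag A = A ->
  exists2 Z : 'M[F]_m, Z *m dag Z = 1%:M & is_diag_mx (Z *m A *m dag Z).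
Proof.
elim: m A => [|m IHm].
  by move=> A _; exists 1%:M; [by apply/matrixP=> - [] | by apply/is_diag_mxP=> - []].
rewrite -[m.+1]/(1 + m)%N => A hA.
have [a /eigenvalueP[v vA /normalize[b [w [b0 vw ww]]]]] := hermitian_eigenvalue hA.
have wA : w *m A = a *: w.
  by apply: (scalerI b0); rewrite scalemxAl -vw vA vw !scalerA mulrC.
(* Factoring the zero matrix against the frame [w] completes [w] to an orthonormal basis; the rows
   of [X] span its orthogonal complement. *)
have [||||_ [X [XX Xw _]]] := @orthogonal_rows_ext m 1 _ 0 w.
- by [].
- by rewrite mul0mx mx0_is_diag.
- by rewrite mul0mx.
- exact: ww.
have [|Z' ZZ dZ] := IHm (X *m A *m dag X); first by rewrite !dagM dagK hA mulmxA.
have wX := dag_mul_comm0 Xw.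
(* The complement of an eigenvector of a self-adjoint matrix is invariant, so the off-diagonal
   blocks vanish. *)
have XAw : X *m A *m dag w = 0.
  by rewrite -mulmxA -{1}hA -dagM wA dagZ -scalemxAr Xw scaler0.
exists (col_mx w (Z' *m X)).
  rewrite dag_col_mx mul_col_row ww dagM !mulmxA wX mul0mx -2!(mulmxA Z').
  by rewrite Xw mulmx0 XX mulmx1 ZZ -scalar_mx_block.
rewrite mul_col_mx dag_col_mx mul_col_row is_diag_block_mx // wA dagM !mulmxA.
rewrite -!scalemxAl wX mul0mx scaler0 ww -scalemx1 -2!(mulmxA Z') XAw mulmx0.
move: dZ; rewrite !eqxx !mulmxA => ->.
by rewrite scale1r scalemx1 scalar_mx_is_diag.
Qed.

(** The diagonal factors carry no sign or order condition, so once [Z] is fixed [U] and [V] can be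
    chosen independently. *)
Lemma cs_decomposition m1 m2 p (Q1 : 'M[F]_(m1, p)) (Q2 : 'M[F]_(m2, p)) :
  (p <= m1)%N -> (p <= m2)%N -> dag Q1 *m Q1 + dag Q2 *m Q2 = 1%:M ->
  exists (U : 'M_m1) (V : 'M_m2) (Z : 'M_p),
   [/\ dag U *m U = 1%:M, dag V *m V = 1%:M, dag Z *m Z = 1%:M,
    is_diag_mx (dag U *m Q1 *m Z) & is_diag_mx (dag V *m Q2 *m Z)].
Proof.
move=> le1 le2 QQ; have [|Z ZZ dZ] := @hermitian_diag _ (dag Q1 *m Q1).
  by rewrite dagM dagK.
have dZ2 : is_diag_mx (Z *m (dag Q2 *m Q2) *m dag Z).
  have -> : dag Q2 *m Q2 = 1%:M - dag Q1 *m Q1 by rewrite -QQ addrC addKr.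
  rewrite mulmxBr mulmxBl mulmx1 ZZ; apply/is_diag_mxP=> i j ij.
  rewrite mxE [1%:M _ _]mxE [(- _ : 'M__) _ _]mxE (is_diag_mxP dZ) //.
  by rewrite -val_eqE (negbTE ij) subr0.
have [|U UU dU] := @orthogonal_cols_diag _ _ (Q1 *m dag Z) le1.
  by rewrite dagM dagK mulmxA -(mulmxA Z).
have [|V VV dV] := @orthogonal_cols_diag _ _ (Q2 *m dag Z) le2.
  by rewrite dagM dagK mulmxA -(mulmxA Z).
by exists (dag U), (dag V), (dag Z); split; rewrite ?dagK -?mulmxA.
Qed.

End Involution.

(** * Real and complex instances *)

Lemma row_norm_gt0 (F : numFieldType) (conj : {rmorphism F -> F}) :
  (forall x, x * conj x = `|x| ^+ 2) ->
  forall m (v : 'rV[F]_m), v != 0 -> 0 < (v *m dag conj v) 0 0.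
Proof.
move=> sq m v /rV0Pn[i vi0]; rewrite mxE (bigD1 i) //= ltr_pwDl //.
  by rewrite dagE sq exprn_gt0 // normr_gt0.
by apply: sumr_ge0 => j _; rewrite dagE sq exprn_ge0.
Qed.

Lemma closed_norm_sqrt (C : numClosedFieldType) m (v : 'rV[C]_m) : v != 0 ->
  exists s, [/\ s^* = s, s != 0 & s * s = (v *m dag Num.conj v) 0 0].
Proof.
move=> /(row_norm_gt0 (fun x => esym (normCK x))) v0.
exists (sqrtC ((v *m dag Num.conj v) 0 0)); split.
- by rewrite conj_Creal // ger0_real // sqrtC_ge0 ltW.
- by rewrite sqrtC_eq0 gt_eqF.
- by rewrite -expr2 sqrtCK.
Qed.

Lemma closed_eigenvalue (C : closedFieldType) m (A : 'M[C]_m.+1) :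
  exists a, eigenvalue A a.
Proof.
have [|a ra] := closed_rootP (char_poly A) _; first by rewrite size_char_poly.
by exists a; rewrite eigenvalue_root_char.
Qed.

(** For an eigenvector [v], the scalar [v A v^*] is self-conjugate and equals [a] times the positive
    number [v v^*]. *)
Lemma hermitian_eigenvalue_real (C : numClosedFieldType) m (A : 'M[C]_m) a :
  dag Num.conj A = A -> eigenvalue A a -> a \is Num.real.
Proof.
move=> hA /eigenvalueP[v vA /(row_norm_gt0 (fun x => esym (normCK x))) v0].
apply/CrealP; apply: (@mulIf _ ((v *m dag Num.conj v) 0 0)); first by rewrite gt_eqF.
have vAv : v *m A *m dag Num.conj v = a *: (v *m dag Num.conj v).
  by rewrite vA scalemxAl.
have /matrixP/(_ 0 0) :
    dag Num.conj (v *m A *m dag Num.conj v) = v *m A *m dag Num.conj v.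
  by rewrite !(dagM, dagK (@conjCK C)) hA mulmxA.
rewrite vAv dagZ dagM (dagK (@conjCK C)); move: (v *m _) => N.
by rewrite mxE [RHS]mxE.
Qed.

Lemma real_norm_sqrt (R : rcfType) m (v : 'rV[R]_m) : v != 0 ->
  exists s, [/\ idfun s = s, s != 0 & s * s = (v *m dag idfun v) 0 0].
Proof.
move=> v0; have {v0}: 0 < (v *m dag idfun v) 0 0.
  by apply: row_norm_gt0 v0 => x; rewrite real_normK ?num_real.
exists (Num.sqrt ((v *m dag idfun v) 0 0)); split=> //.
- by rewrite gt_eqF // sqrtr_gt0.
- by rewrite -expr2 sqr_sqrtr // ltW.
Qed.

Lemma conj_real_complex (R : rcfType) (x : R) : (x%:C%C : R[i])^* = x%:C%C.
Proof. by rewrite conj_Creal // complex_real. Qed.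

Lemma dag_real_complex (R : rcfType) m p (A : 'M[R]_(m, p)) :
  dag Num.conj (map_mx (real_complex R) A) =
  map_mx (real_complex R) (dag idfun A).
Proof. by apply/matrixP=> i j; rewrite dagE !mxE /= conj_real_complex. Qed.

(** An eigenvalue of the complexified matrix is real by the previous argument, hence a root of the
    real characteristic polynomial. *)
Lemma symmetric_eigenvalue (R : rcfType) m (A : 'M[R]_m.+1) :
  dag idfun A = A -> exists a, eigenvalue A a.
Proof.
move=> hA; have [a ea] := closed_eigenvalue (map_mx (real_complex R) A).
have ra : a \is Num.real.
  by apply: hermitian_eigenvalue_real ea; rewrite dag_real_complex hA.
exists (complex.Re a); move: ea; rewrite !eigenvalue_root_char -(RRe_real ra).
by rewrite -map_char_poly fmorph_root.
Qed.

(** In characteristic zero ['X^n - 1] is separable, so it has [n] distinct roots, and that many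
    [n]-th roots of unity include a primitive one. *)
Lemma closed_prim_root (C : numClosedFieldType) n : (0 < n)%N ->
  exists w : C, n.-primitive_root w.
Proof.
move=> n_gt0; have [r] := closed_field_poly_normal ('X^n - 1 : {poly C}).
rewrite (monicP (monicXnsubC _ n_gt0)) scale1r => Xn1.
have r_roots : all n.-unity_root r.
  by apply/allP=> z zr; rewrite /root_of_unity Xn1 root_prod_XsubC.
have r_uniq : uniq r.
  by rewrite -separable_prod_XsubC -Xn1 separable_Xn_sub_1 // pnatr_eq0 -lt0n.
have r_size : size r = n.
  by apply: succn_inj; rewrite -(size_prod_XsubC r id) -Xn1 size_XnsubC.
have [|w _ wn] := hasP (has_prim_root n_gt0 r_roots r_uniq _).
  by rewrite r_size.
by exists w.
Qed.

Lemma cs_decomposition_real (R : rcfType) m1 m2 p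
    (Q1 : 'M[R]_(m1, p)) (Q2 : 'M[R]_(m2, p)) :
  (p <= m1)%N -> (p <= m2)%N ->
  dag idfun Q1 *m Q1 + dag idfun Q2 *m Q2 = 1%:M ->
  exists (U : 'M_m1) (V : 'M_m2) (Z : 'M_p),
   [/\ dag idfun U *m U = 1%:M, dag idfun V *m V = 1%:M, dag idfun Z *m Z = 1%:M,
    is_diag_mx (dag idfun U *m Q1 *m Z) & is_diag_mx (dag idfun V *m Q2 *m Z)].
Proof.
apply: cs_decomposition => //; first exact: real_norm_sqrt.
exact: symmetric_eigenvalue.
Qed.

Lemma is_diag_map (aR rR : nzRingType) (f : {rmorphism aR -> rR}) m p
  (A : 'M[aR]_(m, p)) : is_diag_mx A -> is_diag_mx (map_mx f A).
Proof.
by move/is_diag_mxP=> dA; apply/is_diag_mxP=> i j ij; rewrite mxE dA ?rmorph0.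
Qed.

Lemma map_real_complex_Re (R : rcfType) m p (A : 'M[R[i]]_(m, p)) :
  map_mx Num.conj A = A ->
  map_mx (real_complex R) (map_mx (@complex.Re R) A) = A.
Proof.
move=> cA; apply/matrixP=> i j; rewrite !mxE RRe_real //.
by apply/CrealP; rewrite -[in RHS]cA mxE.
Qed.

(** The last clause is for the slices with [k = - k]: they are real, and their factors must be real
    for the inverse transform to be real. *)
Lemma cs_decomposition_complex (R : rcfType) m1 m2 p
    (Q1 : 'M[R[i]]_(m1, p)) (Q2 : 'M[R[i]]_(m2, p)) :
  (p <= m1)%N -> (p <= m2)%N ->
  dag Num.conj Q1 *m Q1 + dag Num.conj Q2 *m Q2 = 1%:M ->
  exists (U : 'M_m1) (V : 'M_m2) (Z : 'M_p),
   [/\ dag Num.conj U *m U = 1%:M, dag Num.conj V *m V = 1%:M,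
       dag Num.conj Z *m Z = 1%:M,
       is_diag_mx (dag Num.conj U *m Q1 *m Z) &
       is_diag_mx (dag Num.conj V *m Q2 *m Z)] /\
   (map_mx Num.conj Q1 = Q1 -> map_mx Num.conj Q2 = Q2 ->
    [/\ map_mx Num.conj U = U, map_mx Num.conj V = V & map_mx Num.conj Z = Z]).
Proof.
move=> le1 le2 QQ.
have [/andP[/eqP c1 /eqP c2]|ncQ] :=
    boolP ((map_mx Num.conj Q1 == Q1) && (map_mx Num.conj Q2 == Q2)).
  (* Real input: decompose the real parts over [R] and embed the factors back. *)
  pose B1 := map_mx (@complex.Re R) Q1; pose B2 := map_mx (@complex.Re R) Q2.
  have E1 : Q1 = map_mx (real_complex R) B1 by rewrite map_real_complex_Re.
  have E2 : Q2 = map_mx (real_complex R) B2 by rewrite map_real_complex_Re.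
  have BB : dag idfun B1 *m B1 + dag idfun B2 *m B2 = 1%:M.
    apply: (@map_mx_inj _ _ (real_complex R)).
    by rewrite map_mxD !map_mxM -!dag_real_complex -E1 -E2 QQ map_mx1.
  have [U [V [Z [UU VV ZZ dU dV]]]] := cs_decomposition_real le1 le2 BB.
  have fixed k q (A : 'M[R]_(k, q)) :
      map_mx Num.conj (map_mx (real_complex R) A) = map_mx (real_complex R) A.
    by apply/matrixP=> i j; rewrite !mxE /= conj_real_complex.
  exists (map_mx (real_complex R) U), (map_mx (real_complex R) V),
    (map_mx (real_complex R) Z); split=> //.
  rewrite E1 E2 !dag_real_complex -!map_mxM UU VV ZZ !map_mx1.
  by split=> //; apply: is_diag_map.
have [U [V [Z UVZ]]] := cs_decomposition (@conjCK R[i])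
  (@closed_norm_sqrt R[i]) (fun m A _ => closed_eigenvalue A) le1 le2 QQ.
by exists U, V, Z; split=> // c1 c2; move: ncQ; rewrite c1 c2 !eqxx.
Qed.

(** * Indices modulo [l] and sums of roots of unity *)

Lemma submod_inj l (j : 'I_l) : injective (fun i => submod i j).
Proof.
move=> a b /(congr1 val) /= /eqP; rewrite eqn_modDr !modn_small // => /eqP.
exact: val_inj.
Qed.

Lemma oppmodK l : involutive (@oppmod l).
Proof.
(* Index 0 is apart: [l - 0] wraps around to 0, while [l - k] is already reduced for positive
   [k]. *)
move=> [k kl]; apply: val_inj => /=; case: k kl => [|k] kl.
  by rewrite subn0 modnn subn0 modnn.
have l0 := leq_ltn_trans (leq0n _) kl.
rewrite (@modn_small (l - k.+1)) ?ltn_subrL ?l0 //.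
by rewrite subKn ?modn_small // ltnW.
Qed.

Lemma sum_unity_root (F : fieldType) l (x : F) : x ^+ l = 1 -> x != 1 ->
  \sum_(i < l) x ^+ i = 0.
Proof.
move=> xl x1; apply: (@mulfI _ (x - 1)); first by rewrite subr_eq0.
by rewrite -subrX1 xl subrr mulr0.
Qed.

(** * The discrete Fourier transform along the third mode *)

Section Fourier.
Variables (R : realType) (l : nat) (w : R[i]).
Hypothesis w_prim : l.-primitive_root w.

Let l_gt0 : (0 < l)%N := prim_order_gt0 w_prim.

(** The modulus of [w] is a nonnegative number with [l]-th power 1, so it is 1. *)
Lemma prim_root_conj : w * w^* = 1.
Proof.
have wl : `|w| ^+ l = 1 by rewrite -normrX (prim_expr_order w_prim) normr1.
by rewrite -normCK; move/eqP: wl; rewrite pexpr_eq1 // => /eqP->; rewrite expr1n.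
Qed.

Lemma conj_prim_expr_order : (w^*) ^+ l = 1.
Proof. by rewrite -rmorphXn /= (prim_expr_order w_prim) rmorph1. Qed.

Lemma prim_expr_oppmod (k : 'I_l) : w ^+ (oppmod k) = (w^*) ^+ k.
Proof.
rewrite /= (prim_expr_mod w_prim) -[LHS]mulr1 -(expr1n _ k) -prim_root_conj.
by rewrite exprMn mulrA -exprD subnK ?(prim_expr_order w_prim) ?mul1r // ltnW.
Qed.

Lemma prim_expr_submod (i j : 'I_l) : w ^+ (submod i j) * w ^+ j = w ^+ i.
Proof.
rewrite /= (prim_expr_mod w_prim) -exprD -addnA subnK ?exprD; last exact: ltnW.
by rewrite (prim_expr_order w_prim) mulr1.
Qed.

(** A geometric sum of ratio [w ^ (j - k)], which is 1 only for [j = k] because [w] is primitive and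
    both indices are below [l]. *)
Lemma fourier_orthogonality (j k : 'I_l) :
  \sum_(i < l) (w ^+ j * (w^*) ^+ k) ^+ i = if j == k then l%:R else 0.
Proof.
case: eqP => [<-|/eqP njk].
  rewrite -exprMn prim_root_conj expr1n.
  by under eq_bigr do rewrite expr1n; rewrite sumr_const card_ord.
apply: sum_unity_root.
  by rewrite exprMn -!exprM ![(_ * l)%N]mulnC !exprM conj_prim_expr_order
    (prim_expr_order w_prim) !expr1n mulr1.
apply: contra njk => /eqP wjk; apply/eqP/val_inj/eqP.
have: w ^+ j == w ^+ k.
  rewrite -[eqbRHS]mul1r -wjk -mulrA -exprMn [_^* * _]mulrC.
  by rewrite prim_root_conj expr1n mulr1.
by rewrite (eq_prim_root_expr w_prim) !modn_small.
Qed.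

(** Unnormalized, so that products transform without a constant; the factor [l] appears in the
    inversion formula. *)
Definition dft m p (A : tensor R m p l) (k : 'I_l) : 'M[R[i]]_(m, p) :=
  \sum_(j < l) (w ^+ j) ^+ k *: map_mx (real_complex R) (A j).

(** The convolution theorem: the t-product is a cyclic convolution of slices, and [w ^ i] splits as
    [w ^ (i - j) * w ^ j]. *)
Lemma dft_tprod m p q (A : tensor R m p l) (B : tensor R p q l) k :
  dft (tprod A B) k = dft A k *m dft B k.
Proof.
rewrite /dft mulmx_sumr.
under eq_bigr do rewrite tprodE map_mx_sum scaler_sumr.
rewrite exchange_big /=; apply: eq_bigr => j _.
rewrite mulmx_suml [RHS](reindex_inj (@submod_inj l j)); apply: eq_bigr => i _.
rewrite map_mxM -[in LHS](prim_expr_submod i j) exprMn -scalerA.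
by rewrite scalemxAr scalemxAl.
Qed.

(** Reversing the slices negates the exponents of [w], which conjugates the coefficients; the slices
    themselves are real. *)
Lemma dft_ttr m p (A : tensor R m p l) k :
  dft (ttr A) k = dag Num.conj (dft A k).
Proof.
rewrite /dft (reindex_inj (inv_inj (@oppmodK l))) /dag linear_sum map_mx_sum.
apply: eq_bigr => j _; rewrite prim_expr_oppmod !ffunE oppmodK linearZ map_mxZ.
rewrite !rmorphXn; congr (_ *: _).
by apply/matrixP=> a b; rewrite !mxE /= conj_real_complex.
Qed.

Lemma dft_oppmod m p (A : tensor R m p l) k :
  dft A (oppmod k) = map_mx Num.conj (dft A k).
Proof.
rewrite /dft map_mx_sum; apply: eq_bigr => j _.
rewrite map_mxZ !rmorphXn /= exprAC prim_expr_oppmod exprAC; congr (_ *: _).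
by apply/matrixP=> a b; rewrite !mxE /= conj_real_complex.
Qed.

Lemma dftD m p (A B : tensor R m p l) k : dft (A + B) k = dft A k + dft B k.
Proof.
rewrite /dft -big_split; apply: eq_bigr => j _.
by rewrite ffunE map_mxD scalerDr.
Qed.

Lemma dft0 m p k : dft (0 : tensor R m p l) k = 0.
Proof. by rewrite /dft big1 // => j _; rewrite ffunE map_mx0 scaler0. Qed.

Lemma dft_tid m k : dft (tid R m l) k = 1%:M.
Proof.
rewrite /dft (bigD1 (Ordinal l_gt0)) //= !ffunE /= expr0 expr1n scale1r map_mx1.
rewrite big1 ?addr0 // => j; rewrite -val_eqE ffunE /= => /negbTE->.
by rewrite map_mx0 scaler0.
Qed.

Lemma dft_tcol m1 m2 p (A : tensor R m1 p l) (B : tensor R m2 p l) k :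
  dft (tcol A B) k = col_mx (dft A k) (dft B k).
Proof.
rewrite /dft; elim/big_rec3: _ => [|j X Y Z _ ->]; first by rewrite col_mx0.
by rewrite ffunE map_col_mx scale_col_mx add_col_mx.
Qed.

Lemma dft_tblock m1 m2 p1 p2 (A : tensor R m1 p1 l) (B : tensor R m1 p2 l)
    (C : tensor R m2 p1 l) (D : tensor R m2 p2 l) k :
  dft (tblock A B C D) k = block_mx (dft A k) (dft B k) (dft C k) (dft D k).
Proof.
apply/matrixP=> i j; rewrite -(splitK i) -(splitK j) /dft summxE.
have blockE := (block_mxEul, block_mxEur, block_mxEdl, block_mxEdr).
by case: (split i) (split j) => a [] b; rewrite ?blockE summxE;
  apply: eq_bigr => c _; rewrite ffunE map_block_mx scale_block_mx ?blockE.
Qed.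

(** After exchanging the sums, orthogonality keeps only the term [j = i]. *)
Lemma dft_inversion m p (A : tensor R m p l) i :
  l%:R *: map_mx (real_complex R) (A i) =
  \sum_(k < l) ((w^*) ^+ i) ^+ k *: dft A k.
Proof.
rewrite /dft; under eq_bigr do rewrite scaler_sumr.
rewrite exchange_big /=.
under eq_bigr => j _.
  under eq_bigr do rewrite scalerA -exprMn mulrC.
  rewrite -scaler_suml fourier_orthogonality; over.
rewrite (bigD1 i) //= eqxx big1 ?addr0 // => j /negbTE->.
by rewrite scale0r.
Qed.

Lemma order_neq0 : l%:R != 0 :> R[i].
Proof. by rewrite pnatr_eq0 -lt0n. Qed.

Lemma dft_inj m p (A B : tensor R m p l) :
  (forall k, dft A k = dft B k) -> A = B.
Proof.
move=> AB; apply/ffunP=> i; apply: (@map_mx_inj _ _ (real_complex R)).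
apply: (scalerI order_neq0); rewrite !dft_inversion.
by apply: eq_bigr => k _; rewrite AB.
Qed.

(** By inversion each slice is a linear combination of the transformed slices. *)
Lemma f_diagonal_dft m p (A : tensor R m p l) :
  (forall k, is_diag_mx (dft A k)) -> f_diagonal A.
Proof.
move=> dA i; apply/is_diag_mxP=> a b ab.
have := congr1 (fun M : 'M__ => M a b) (dft_inversion A i).
rewrite summxE big1 => [|k _]; last by rewrite mxE (is_diag_mxP (dA k)) ?mulr0.
by rewrite !mxE => /eqP; rewrite mulf_eq0 (negbTE order_neq0) fmorph_eq0 => /eqP.
Qed.

(** The symmetry of [B] makes its inverse transform [E] real, so taking real parts loses nothing. *)
Lemma dft_surj m p (B : 'I_l -> 'M[R[i]]_(m, p)) :
  (forall k, B (oppmod k) = map_mx Num.conj (B k)) ->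
  exists A : tensor R m p l, forall k, dft A k = B k.
Proof.
move=> cB; pose E (i : 'I_l) := l%:R^-1 *: \sum_(k < l) ((w^*) ^+ i) ^+ k *: B k.
(* Conjugation sends the term of [k] to that of [- k] and so only permutes the sum. *)
have realE i : map_mx (real_complex R) (map_mx (@complex.Re R) (E i)) = E i.
  apply: map_real_complex_Re; rewrite map_mxZ fmorphV rmorph_nat; congr (_ *: _).
  rewrite map_mx_sum [RHS](reindex_inj (inv_inj (@oppmodK l))).
  apply: eq_bigr => k _; rewrite map_mxZ -cB; congr (_ *: _).
  rewrite !rmorphXn /= conjCK exprAC [RHS]exprAC.
  by rewrite -(prim_expr_oppmod (oppmod k)) oppmodK.
exists [ffun i => map_mx (@complex.Re R) (E i)] => k.
rewrite /dft; under eq_bigr => j _ do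
  rewrite ffunE realE /E scalerA mulrC -scalerA scaler_sumr.
rewrite -scaler_sumr exchange_big /=.
under eq_bigr => k' _.
  under eq_bigr => j _ do
    rewrite scalerA -!exprM mulnC [(j * k')%N]mulnC !exprM -exprMn.
  rewrite -scaler_suml fourier_orthogonality; over.
rewrite (bigD1 k) //= eqxx big1 => [|k' /negbTE]; last first.
  by rewrite eq_sym => ->; rewrite scale0r.
by rewrite addr0 scalerA mulVf ?scale1r // order_neq0.
Qed.

End Fourier.

(** * Assembling the slicewise decompositions *)

Lemma oppmod_equivariant_choice l (T : Type) (c : T -> T)
    (P : 'I_l -> T -> Prop) :
  involutive c -> (forall k t, P k t -> P (oppmod k) (c t)) ->
  (forall k, exists t, P k t /\ (oppmod k = k -> c t = t)) ->
  exists f, forall k, P k (f k) /\ f (oppmod k) = c (f k).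
Proof.
move=> cK Pc /fin_all_exists[g gP].
(* The smaller of [k] and [- k] keeps its own choice and the other index gets the image under [c];
   when they coincide, the choice is fixed by [c]. *)
exists (fun k : 'I_l => if (k <= oppmod k)%N then g k else c (g (oppmod k))) => k.
split.
  case: leqP => _; first by case: (gP k).
  by rewrite -[k in P k]oppmodK; apply: Pc; case: (gP (oppmod k)).
rewrite oppmodK; case: ltngtP => [lt|lt|/val_inj eqk].
- by rewrite ?cK.
- by rewrite ?cK.
- by have [_ ->] := gP k; rewrite eqk.
Qed.

(** One side suffices because a left inverse of a square slice is also a right inverse. *)
Lemma torthogonal_dft (R : realType) l (w : R[i]) m (U : tensor R m m l) :
  l.-primitive_root w ->
  (forall k, dag Num.conj (dft w U k) *m dft w U k = 1%:M) -> torthogonal U.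
Proof.
move=> wl UU; split; apply: (dft_inj wl) => k.
  by rewrite dft_tprod // dft_ttr // dft_tid.
by rewrite dft_tprod // dft_ttr // dft_tid //; apply: mulmx1C.
Qed.

Theorem theorem3p1 (R : realType) (m1 m2 n1 n : nat)
    (m1_gt0 : (0 < m1)%N) (m2_gt0 : (0 < m2)%N)
    (n1_gt0 : (0 < n1)%N) (n_gt0 : (0 < n)%N)
    (le_n1_m1 : (n1 <= m1)%N) (le_n1_m2 : (n1 <= m2)%N)
    (Q1 : tensor R m1 n1 n) (Q2 : tensor R m2 n1 n)
    (Q_porth : tpartially_orthogonal (tcol Q1 Q2)) :
  exists (U : tensor R m1 m1 n) (V : tensor R m2 m2 n) (Z : tensor R n1 n1 n),
    [/\ torthogonal U, torthogonal V, torthogonal Z &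
      exists (C : tensor R m1 n1 n) (S : tensor R m2 n1 n),
        [/\ tprod (tprod (ttr (tblock U 0 0 V)) (tcol Q1 Q2)) Z = tcol C S,
            f_diagonal C, f_diagonal S &
            tprod (ttr C) C + tprod (ttr S) S = tid R n1 n]].
Proof.
have [w wn] := closed_prim_root R[i] n_gt0.
have QQ k : dag Num.conj (dft w Q1 k) *m dft w Q1 k +
            dag Num.conj (dft w Q2 k) *m dft w Q2 k = 1%:M.
  have := congr1 (fun A => dft w A k) Q_porth.
  by rewrite /= dft_tprod // dft_ttr // dft_tid // dft_tcol dag_col_mx mul_row_col.
pose T := ('M[R[i]]_m1 * 'M[R[i]]_m2 * 'M[R[i]]_n1)%type.
pose P k (t : T) := let: (U, V, Z) := t in
  [/\ dag Num.conj U *m U = 1%:M, dag Num.conj V *m V = 1%:M,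
      dag Num.conj Z *m Z = 1%:M,
      is_diag_mx (dag Num.conj U *m dft w Q1 k *m Z) &
      is_diag_mx (dag Num.conj V *m dft w Q2 k *m Z)].
pose c (t : T) : T := let: (U, V, Z) := t in
  (map_mx Num.conj U, map_mx Num.conj V, map_mx Num.conj Z).
have conj_mxK m p :
    involutive (map_mx Num.conj : 'M[R[i]]_(m, p) -> 'M_(m, p)).
  by move=> A; apply/matrixP=> i j; rewrite !mxE conjCK.
have [|||f fP] := @oppmod_equivariant_choice n _ c P.
- by move=> [[U V] Z]; rewrite /c !conj_mxK.
- have dag_conj m p (A : 'M[R[i]]_(m, p)) :
    dag Num.conj (map_mx Num.conj A) = map_mx Num.conj (dag Num.conj A).
    by rewrite /dag map_trmx.
  move=> k [[U V] Z] /= [UU VV ZZ dU dV]; rewrite !dft_oppmod //.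
  by rewrite !dag_conj -!map_mxM UU VV ZZ !map_mx1; split=> //; apply: is_diag_map.
(* If [k = - k], both slices equal their conjugates, so the factors come out self-conjugate. *)
- move=> k; have [U [V [Z [PUVZ cUVZ]]]] :=
    cs_decomposition_complex le_n1_m1 le_n1_m2 (QQ k).
  exists (U, V, Z); split=> // kk.
  by have [||/= -> -> ->] := cUVZ; rewrite -?dft_oppmod // kk.
have [|U fU] := @dft_surj R n w wn _ _ (fun k => (f k).1.1).
  by move=> k; have [_ ->] := fP k; case: (f k) => [[]].
have [|V fV] := @dft_surj R n w wn _ _ (fun k => (f k).1.2).
  by move=> k; have [_ ->] := fP k; case: (f k) => [[]].
have [|Z fZ] := @dft_surj R n w wn _ _ (fun k => (f k).2).
  by move=> k; have [_ ->] := fP k; case: (f k) => [[]].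
have {}fP k : P k (dft w U k, dft w V k, dft w Z k).
  by rewrite fU fV fZ; case: (fP k) => + _; case: (f k) => [[]].
pose C := tprod (tprod (ttr U) Q1) Z; pose S := tprod (tprod (ttr V) Q2) Z.
have dftC k : dft w C k = dag Num.conj (dft w U k) *m dft w Q1 k *m dft w Z k.
  by rewrite !dft_tprod // dft_ttr.
have dftS k : dft w S k = dag Num.conj (dft w V k) *m dft w Q2 k *m dft w Z k.
  by rewrite !dft_tprod // dft_ttr.
exists U, V, Z; split; do ?by apply: (torthogonal_dft wn) => k; case: (fP k).
exists C, S; split.
- apply: (dft_inj wn) => k; rewrite !dft_tprod // dft_ttr // dft_tblock.
  rewrite !dft_tcol !dft0 dag_block_mx !dag0 mul_block_col !mul0mx addr0 add0r.
  by rewrite mul_col_mx dftC dftS.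
- by apply: (f_diagonal_dft wn) => k; rewrite dftC; case: (fP k).
- by apply: (f_diagonal_dft wn) => k; rewrite dftS; case: (fP k).
apply: (dft_inj wn) => k.
rewrite dftD !dft_tprod // !dft_ttr // dft_tid // dftC dftS.
(* With [U U^* = 1] and [V V^* = 1] the sum collapses to [Z^* (Q1^* Q1 + Q2^* Q2) Z]. *)
have [/mulmx1C UU /mulmx1C VV ZZ _ _] := fP k.
rewrite !(dagM, dagK (@conjCK R[i])).
rewrite !mulmxA -!(mulmxA _ (dft w U k)) -!(mulmxA _ (dft w V k)) UU VV !mulmx1.
by rewrite -mulmxDl -!mulmxA -mulmxDr QQ mulmx1.
Qed.
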